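(* Let $n,k\ge1$. Let $W$ be a finite-dimensional real continuous representation of $\mathrm{SO}(3)\times S_n$ that is admissible for non-affine activations. Then every $\mathrm{SO}(3)\times S_n$-equivariant linear layer (linear map) $\mathbb R^3\otimes(\mathbb R^n)^{\otimes k}\to W$ is zero. Hence every $\mathrm{E}(3)\times S_n$-equivariant network on $\mathbb R^3\otimes(\mathbb R^n)^{\otimes k}$ with point-wise activations induced by non-affine continuous functions is rotation invariant, i.e. its output is unchanged when its input is acted on by an element of $\mathrm{SO}(3)\subset\mathrm{E}(3)$.
   Context: $\mathrm{SO}(3)$ is the group of real orthogonal $3\times3$ matrices with positive determinant, $\mathrm{E}(3)$ is the group of isometries of $\mathbb R^3$, and $S_n$ is the symmetric group. $\mathrm{SO}(3)$ acts on $\mathbb R^3$ by matrix multiplication, $S_n$ acts on $(\mathbb R^n)^{\otimes k}$ by $\sigma(e_{i_1}\otimes\cdots\otimes e_{i_k})=e_{\sigma(i_1)}\otimes\cdots\otimes e_{\sigma(i_k)}$, and $\mathrm{SO}(3)\times S_n$ acts on $\mathbb R^3\otimes(\mathbb R^n)^{\otimes k}$ by the tensor product action. $\mathrm{E}(3)$ acts on $\mathbb R^3\otimes(\mathbb R^n)^{\otimes k}\cong(\mathbb R^3)^{n^k}$ by applying the isometry to each $\mathbb R^3$-valued coordinate. For a finite-dimensional real vector space $V$ with basis $\mathcal B=\{v_1,\dots,v_d\}$ and continuous $f:\mathbb R\to\mathbb R$, the point-wise activation induced by $f$ on $\mathcal B$ is $\tilde f(\sum_i a_iv_i)=\sum_i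 f(a_i)v_i$. A representation $V$ of a group $G$ is admissible for non-affine activations if, for some basis $\mathcal B$ and some continuous non-affine $f$ (not of the form $x\mapsto ax+c$), $\tilde f$ is $G$-equivariant ($\tilde f(gv)=g\tilde f(v)$ for all $g\in G$, $v\in V$). A $G$-equivariant network is a composition $\Phi=\phi_m\circ\tilde f_{m}\circ\phi_{m-1}\circ\cdots\circ\tilde f_1\circ\phi_0$ with $m\ge1$, where $\phi_i:V_i\to V_{i+1}$ are affine $G$-equivariant maps, $V_0$ is the input space, the $V_i$ with $i\ge1$ are finite-dimensional real continuous $G$-representations, and each $\tilde f_i:V_i\to V_i$ is a $G$-equivariant point-wise activation (with respect to some basis of $V_i$). *)

(* Defs.v *)
From HB Require Import structures.
From mathcomp Require Import all_boot all_order perm all_algebra.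
From mathcomp Require Import all_classical reals topology normedtype.
Set Implicit Arguments.
Unset Strict Implicit.
Unset Printing Implicit Defensive.
Import Order.TTheory GRing.Theory Num.Theory.
Import numFieldNormedType.Exports.

Local Open Scope classical_set_scope.
Local Open Scope ring_scope.

(* Continuity of the group operations is not required: only the topology of G
   matters for continuity of a representation. *)
#[short(type="topGroupType")]
HB.structure Definition TopGroup := {G of Group G & Topological G}.

HB.instance Definition _ (G H : topGroupType) := Group.on (G * H)%type.

Section SpecialOrthogonal.
Variable R : realType.

Definition special_orthogonal (A : 'M[R]_3) : bool :=
  (A^T *m A == 1%:M) && (0 < \det A).

Record SO3 := MkSO3 { so3_mx : 'M[R]_3; so3_mxP : special_orthogonal so3_mx }.

HB.instance Definition _ := [isSub for so3_mx].
HB.instance Definition _ := [Choice of SO3 by <:].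

Fact so3_one_subproof : special_orthogonal 1%:M.
Proof. by rewrite /special_orthogonal trmx1 mulmx1 eqxx det1 ltr01. Qed.

Fact so3_mul_subproof (A B : SO3) : special_orthogonal (so3_mx A *m so3_mx B).
Proof.
have /andP[/eqP oA dA] := so3_mxP A; have /andP[/eqP oB dB] := so3_mxP B.
apply/andP; split; last by rewrite det_mulmx mulr_gt0.
by rewrite trmx_mul mulmxA -[_ *m _ *m so3_mx A]mulmxA oA mulmx1 oB.
Qed.

Fact so3_inv_subproof (A : SO3) : special_orthogonal (so3_mx A)^T.
Proof.
have /andP[/eqP oA dA] := so3_mxP A.
by apply/andP; rewrite trmxK det_tr (mulmx1C oA).
Qed.

Definition so3_one := MkSO3 so3_one_subproof.
Definition so3_mul A B := MkSO3 (so3_mul_subproof A B).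
Definition so3_inv A := MkSO3 (so3_inv_subproof A).

Fact so3_mulA : associative so3_mul.
Proof. by move=> A B C; apply: val_inj; rewrite /= mulmxA. Qed.
Fact so3_mul1 : left_id so3_one so3_mul.
Proof. by move=> A; apply: val_inj; rewrite /= mul1mx. Qed.
Fact so3_mulr1 : right_id so3_one so3_mul.
Proof. by move=> A; apply: val_inj; rewrite /= mulmx1. Qed.
Fact so3_mulV : left_inverse so3_one so3_inv so3_mul.
Proof. by move=> A; apply: val_inj; have /andP[/eqP] := so3_mxP A. Qed.
Fact so3_mulrV : right_inverse so3_one so3_inv so3_mul.
Proof.
by move=> A; apply: val_inj => /=; have /andP[/eqP/mulmx1C] := so3_mxP A.
Qed.

HB.instance Definition _ := isGroup.Build SO3
  so3_mulA so3_mul1 so3_mulr1 so3_mulV so3_mulrV.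
HB.instance Definition _ := Topological.copy SO3 (initial_topology so3_mx).

End SpecialOrthogonal.

Section Euclidean.
Variable R : realType.

(* The library norm on matrices is the sup norm, hence this explicit distance. *)
Definition edist (x y : 'cV[R]_3) : R :=
  Num.sqrt (\sum_i (x i ord0 - y i ord0) ^+ 2).

Record E3 := MkE3 {
  e3_fun :> 'cV[R]_3 -> 'cV[R]_3;
  e3_isometry : forall x y, edist (e3_fun x) (e3_fun y) = edist x y;
  e3_surj : forall y, exists x, e3_fun x = y }.

HB.instance Definition _ := gen_eqMixin E3.
HB.instance Definition _ := gen_choiceMixin E3.

Lemma e3_ext (f g : E3) : f =1 g -> f = g.
Proof.
case: f g => [f fi fs] [g gi gs] /= /funext fg; case: _ / fg in gi gs *.
by congr MkE3; exact: Prop_irrelevance.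
Qed.

Lemma edist_eq0 x y : edist x y = 0 -> x = y.
Proof.
move=> /eqP; rewrite sqrtr_eq0 => le0.
have /eqP/psumr_eq0P xy : \sum_i (x i ord0 - y i ord0) ^+ 2 == 0.
  by rewrite eq_le le0 sumr_ge0// => i _; rewrite sqr_ge0.
apply/colP => i; apply/eqP; rewrite -subr_eq0 -sqrf_eq0 xy// => j _.
exact: sqr_ge0.
Qed.

Lemma edistxx x : edist x x = 0.
Proof. by rewrite /edist big1 ?sqrtr0// => i _; rewrite subrr expr0n. Qed.

Definition e3_one : E3 :=
  @MkE3 id (fun _ _ => erefl) (fun y => ex_intro _ y erefl).

Fact e3_mul_isometry (f g : E3) x y : edist (f (g x)) (f (g y)) = edist x y.
Proof. by rewrite !e3_isometry. Qed.
Fact e3_mul_surj (f g : E3) y : exists x, f (g x) = y.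
Proof. by have [z <-] := e3_surj f y; have [x <-] := e3_surj g z; exists x. Qed.
Definition e3_mul (f g : E3) : E3 :=
  @MkE3 (fun x => f (g x)) (e3_mul_isometry f g) (e3_mul_surj f g).

Definition e3_inv_fun (f : E3) y := sval (cid (e3_surj f y)).
Fact e3_inv_funK (f : E3) : cancel (e3_inv_fun f) f.
Proof. by move=> y; rewrite /e3_inv_fun; case: cid. Qed.
Fact e3_funK (f : E3) : cancel f (e3_inv_fun f).
Proof.
by move=> x; apply: edist_eq0; rewrite -(e3_isometry f) e3_inv_funK edistxx.
Qed.
Fact e3_inv_isometry (f : E3) x y :
  edist (e3_inv_fun f x) (e3_inv_fun f y) = edist x y.
Proof. by rewrite -(e3_isometry f) !e3_inv_funK. Qed.
Fact e3_inv_surj (f : E3) y : exists x, e3_inv_fun f x = y.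
Proof. by exists (f y); rewrite e3_funK. Qed.
Definition e3_inv (f : E3) : E3 :=
  MkE3 (e3_inv_isometry f) (e3_inv_surj f).

Fact e3_mulA : associative e3_mul. Proof. by move=> f g h; exact: e3_ext. Qed.
Fact e3_mul1 : left_id e3_one e3_mul. Proof. by move=> f; exact: e3_ext. Qed.
Fact e3_mulr1 : right_id e3_one e3_mul. Proof. by move=> f; exact: e3_ext. Qed.
Fact e3_mulV : left_inverse e3_one e3_inv e3_mul.
Proof. by move=> f; apply: e3_ext => x /=; rewrite e3_funK. Qed.
Fact e3_mulrV : right_inverse e3_one e3_inv e3_mul.
Proof. by move=> f; apply: e3_ext => x /=; rewrite e3_inv_funK. Qed.

HB.instance Definition _ := isGroup.Build E3
  e3_mulA e3_mul1 e3_mulr1 e3_mulV e3_mulrV.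

(* Pointwise convergence: on isometries it coincides with uniform convergence
   on compact sets, i.e. with the usual Lie group topology of E(3). *)
Definition e3_ptws (f : E3) : {ptws 'cV[R]_3 -> 'cV[R]_3} := e3_fun f.
HB.instance Definition _ := Topological.copy E3 (initial_topology e3_ptws).

Fact rotation_isometry (A : SO3 R) (x y : 'cV[R]_3) :
  edist (so3_mx A *m x) (so3_mx A *m y) = edist x y.
Proof.
have edistE u v : edist u v = Num.sqrt (((u - v)^T *m (u - v)) ord0 ord0).
  congr Num.sqrt; rewrite mxE; apply: eq_bigr => i _.
  by rewrite !mxE expr2.
have /andP[/eqP oA _] := so3_mxP A.
by rewrite !edistE -mulmxBr trmx_mul mulmxA -[_ *m _ *m so3_mx A]mulmxA oA mulmx1.
Qed.
Fact rotation_surj (A : SO3 R) (y : 'cV[R]_3) : exists x : 'cV[R]_3, so3_mx A *m x = y.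
Proof.
have /andP[/eqP/mulmx1C oA _] := so3_mxP A.
by exists ((so3_mx A)^T *m y); rewrite mulmxA oA mul1mx.
Qed.
Definition rotation (A : SO3 R) : E3 :=
  MkE3 (rotation_isometry A) (rotation_surj A).

End Euclidean.

(* 'S_n with the product (s * t)(i) = s (t i); the product of 'S_n itself is
   composition in the opposite order, which would make s . e_i = e_(s i) a
   right action. *)
Definition symg (n : nat) : Type := 'S_n.

Section SymmetricGroup.
Variable n : nat.

HB.instance Definition _ := Choice.copy (symg n) 'S_n.

Definition symg_mul (s t : symg n) : symg n := ((t : 'S_n) * (s : 'S_n))%g.

Fact symg_mulA : associative symg_mul.
Proof. by move=> s t u; rewrite /symg_mul mulgA. Qed.
Fact symg_mul1 : left_id (1%g : 'S_n) symg_mul.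
Proof. by move=> s; rewrite /symg_mul mulg1. Qed.
Fact symg_mulr1 : right_id (1%g : 'S_n) symg_mul.
Proof. by move=> s; rewrite /symg_mul mul1g. Qed.
Fact symg_mulV : left_inverse (1%g : 'S_n) (fun s : 'S_n => s^-1%g) symg_mul.
Proof. by move=> s; rewrite /symg_mul mulgV. Qed.
Fact symg_mulrV : right_inverse (1%g : 'S_n) (fun s : 'S_n => s^-1%g) symg_mul.
Proof. by move=> s; rewrite /symg_mul mulVg. Qed.

HB.instance Definition _ := isGroup.Build (symg n)
  symg_mulA symg_mul1 symg_mulr1 symg_mulV symg_mulrV.
HB.instance Definition _ :=
  Topological.copy (symg n) (discrete_topology (symg n)).

Lemma symg_mulE (s t : symg n) i :
  ((s * t)%g : 'S_n) i = (s : 'S_n) ((t : 'S_n) i).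
Proof. exact: permM. Qed.

End SymmetricGroup.

(* R^3 (x) (R^n)^(x)k in coordinates: x I is the R^3-valued coefficient of
   e_(I 0) (x) ... (x) e_(I (k-1)). *)
Section TensorInput.
Variables (R : realType) (n k : nat).

Definition multi_index : Type := {ffun 'I_k -> 'I_n}.
HB.instance Definition _ := Finite.on multi_index.

Definition tensors : Type := {ffun multi_index -> 'cV[R]_3}.
HB.instance Definition _ := Vector.copy tensors {ffun multi_index -> 'cV[R]_3}.

Definition pure_tensor (v : 'cV[R]_3) (I : multi_index) : tensors :=
  [ffun J => if J == I then v else 0].

Definition perm_index (s : symg n) (I : multi_index) : multi_index :=
  [ffun j => (s : 'S_n) (I j)].

Definition so3_tensor_act (g : SO3 R * symg n) (x : tensors) : tensors :=
  [ffun I => so3_mx g.1 *m x (perm_index g.2^-1%g I)].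

Definition e3_tensor_act (g : E3 R * symg n) (x : tensors) : tensors :=
  [ffun I => g.1 (x (perm_index g.2^-1%g I))].

Lemma perm_index_eq (s : symg n) I J :
  (perm_index s^-1%g J == I) = (J == perm_index s I).
Proof.
apply/eqP/eqP => [<-|->]; apply/ffunP => j; rewrite !ffunE.
  by rewrite -symg_mulE mulgV perm1.
by rewrite -symg_mulE mulVg perm1.
Qed.

(* (A, s) . (v (x) e_I) = A v (x) e_(s I) *)
Lemma so3_tensor_act_pure A s v I :
  so3_tensor_act (A, s) (pure_tensor v I) =
  pure_tensor (so3_mx A *m v) (perm_index s I).
Proof.
by apply/ffunP => J; rewrite !ffunE perm_index_eq; case: ifP; rewrite ?mulmx0.
Qed.

Lemma so3_tensor_act_linear g : linear (so3_tensor_act g).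
Proof. by move=> a x y; apply/ffunP => I; rewrite !ffunE linearP. Qed.

Lemma e3_tensor_act_rotation A s x :
  e3_tensor_act (rotation A, s) x = so3_tensor_act (A, s) x.
Proof. by apply/ffunP => I; rewrite !ffunE. Qed.

End TensorInput.

Section Networks.
Variables (R : realType) (G : topGroupType).

(* The matrix coefficients g |-> l (rho g v) are continuous; in finite dimension
   this is continuity of G -> GL(V), equivalently of G x V -> V. *)
Record representation (V : vectType R) := Representation {
  rep_fun : G -> 'End(V);
  rep1 : rep_fun 1%g = \1%VF;
  repM : forall g h, rep_fun (g * h)%g = (rep_fun g \o rep_fun h)%VF;
  rep_continuous : forall (l : 'Hom(V, R^o)) (v : V),
    continuous (fun g => l (rep_fun g v) : R^o) }.

Definition rep_act (V : vectType R) (rho : representation V) (g : G) (v : V) : V :=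
  rep_fun rho g v.
Coercion rep_act : representation >-> Funclass.

Definition equivariant (U V : Type) (actU : G -> U -> U) (actV : G -> V -> V)
    (phi : U -> V) :=
  forall g u, phi (actU g u) = actV g (phi u).

Definition affine_function (f : R -> R) :=
  exists a c, forall x, f x = a * x + c.

Definition affine_map (U V : lmodType R) (phi : U -> V) :=
  exists (L : {linear U -> V}) (b : V), forall u, phi u = L u + b.

Definition pointwise_activation (V : vectType R) (X : (\dim {:V}).-tuple V)
    (f : R -> R) (v : V) : V :=
  \sum_i f (coord X i v) *: X`_i.

Definition admissible_nonaffine (V : vectType R) (rho : representation V) :=
  exists (X : (\dim {:V}).-tuple V) (f : R -> R),
    [/\ basis_of {:V} X, continuous f, ~ affine_function f &
        equivariant rho rho (pointwise_activation X f)].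

(* [network actU P m rho Phi]: Phi is the composition of m + 1 affine
   equivariant layers with m equivariant point-wise activations in between,
   each induced by a continuous function satisfying P; the input space U
   carries an arbitrary action, the output space the representation rho. *)
Inductive network (U : lmodType R) (actU : G -> U -> U) (P : (R -> R) -> Prop) :
    nat -> forall V : vectType R, representation V -> (U -> V) -> Prop :=
| network_first (V : vectType R) (rho : representation V) (phi : U -> V) :
    affine_map phi -> equivariant actU rho phi ->
    network actU P 0 rho phi
| network_next (m : nat) (V W : vectType R)
    (rho : representation V) (sigma : representation W) (Phi : U -> V)
    (X : (\dim {:V}).-tuple V) (f : R -> R) (phi : V -> W) :
    network actU P m rho Phi ->
    basis_of {:V} X -> continuous f -> P f ->
    equivariant rho rho (pointwise_activation X f) ->
    affine_map phi -> equivariant rho sigma phi ->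
    network actU P m.+1 sigma (fun u => phi (pointwise_activation X f (Phi u))).

End Networks.

(* Main.v *)
Require Import Defs.
From HB Require Import structures.
From mathcomp Require Import all_boot all_order perm all_algebra.
From mathcomp Require Import all_classical reals topology normedtype.
From mathcomp Require Import ring.
Set Implicit Arguments.
Unset Strict Implicit.
Unset Printing Implicit Defensive.
Import Order.TTheory GRing.Theory Num.Theory.
Import numFieldNormedType.Exports.
Local Open Scope classical_set_scope.
Local Open Scope ring_scope.

(** If a linear map commutes with a point-wise non-affine activation, each row
   of its matrix has at most one nonzero entry.  Hence the coordinate functionals
   of W are permuted up to scalars by the group, and so are their pullbacks to
   R^3 along an equivariant linear layer restricted to R^3 (x) e_I.  The
   pullbacks lie on finitely many lines, whereas a nonzero vector of R^3 has
   rotated copies on infinitely many lines, so they all vanish.  The linear part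
   of the first layer of a network is therefore zero, and the network is even
   constant. *)

(** * Functional equations and monomial matrices *)

Lemma continuous_additive_linear (R : realType) (h : R -> R) :
  continuous h -> {morph h : x y / x + y} -> forall x, h x = x * h 1.
Proof.
move=> ch hD.
have h0 : h 0 = 0 by apply: (addrI (h 0)); rewrite -hD !addr0.
have hN x : h (- x) = - h x by apply: (addrI (h x)); rewrite -hD !subrr.
have hMn x m : h (x *+ m) = h x *+ m.
  by elim: m => [|m IH]; rewrite ?mulr0n// !mulrS hD IH.
have hMz x m : h (x *~ m) = h x *~ m.
  by case: m => m; rewrite ?NegzE ?mulrNz ?hN -!pmulrn hMn.
have hQ (q : rat) : h (ratr q) = ratr q * h 1.
  have dq0 : (denq q)%:~R != 0 :> R by rewrite intr_eq0 denq_neq0.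
  have ratrE : ratr q *~ denq q = 1 *~ numq q :> R.
    by rewrite -mulrzr /ratr divfK.
  apply: (mulIf dq0); rewrite mulrzr -hMz ratrE hMz.
  by rewrite -mulrzl mulrAC mulrzr ratrE.
(* If [h x - x * h 1] were nonzero, continuity would keep [h y - y * h 1] nonzero for [y] in a ball
   around [x]; that ball contains a rational, where the difference vanishes by [hQ]. *)
move=> x; apply/eqP; rewrite -subr_eq0 -normr_eq0; apply/negPn/negP => dx.
have e0 : 0 < `|h x - x * h 1| by rewrite lt_def dx normr_ge0.
have cg : {for x, continuous (fun y : R => h y - y * h 1)}.
  apply: continuousB; first exact: ch.
  by apply: continuousM; [exact: cvg_id|exact: cvg_cst].
have /cvgrPdist_lt/(_ _ e0)/nbhs_ballP[r /= r0 rP] := cg.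
have [q /[!in_itv]/= /andP[xq qx]] := rat_in_itvoo (ltr_pwDr r0 (lexx x)).
have /rP /= : ball x r (ratr q).
  by rewrite /ball/= distrC gtr0_norm ?subr_gt0// ltrBlDl.
by rewrite hQ subrr subr0 ltxx.
Qed.

(* Two nonzero coefficients turn the hypothesis into Pexider's equation
   f (a + b) = p a + q b. *)
Lemma affine_of_commute_combination (R : realType) (d : nat) (f : R -> R)
    (m : 'I_d -> R) (j l : 'I_d) :
  continuous f ->
  (forall w : 'I_d -> R, f (\sum_i w i * m i) = \sum_i f (w i) * m i) ->
  j != l -> m j != 0 -> m l != 0 -> affine_function f.
Proof.
move=> cf fm jl mj ml.
(* [f 0] may be nonzero, so the indices where [w] below is zero contribute the constant [C]. *)
pose C := \sum_(i | (i != j) && (i != l)) f 0 * m i.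
have fE a b : f (a + b) = f (a / m j) * m j + (f (b / m l) * m l + C).
  pose w i := if i == j then a / m j else if i == l then b / m l else 0.
  have wE (F : R -> R) : \sum_i F (w i) * m i = F (a / m j) * m j +
      (F (b / m l) * m l + \sum_(i | (i != j) && (i != l)) F 0 * m i).
    rewrite (bigD1 j)// (bigD1 l) 1?eq_sym//= /w !eqxx eq_sym (negbTE jl).
    congr (_ + (_ + _)).
    by apply: eq_bigr => i /andP[/negbTE-> /negbTE->].
  rewrite -wE -fm (wE id) !divfK// big1 ?addr0// => i _; exact: mul0r.
have hD : {morph (fun x => f x - f 0) : x y / x + y}.
  move=> a b /=.
  (* [fE a b + fE 0 0 = fE a 0 + fE 0 b] on right-hand sides, so [f (a + b) + f 0 = f a + f b]. *)
  have := fE a b; have := fE a 0; have := fE 0 b; have := fE 0 0.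
  by rewrite !addr0 add0r => -> -> -> ->; ring.
have ch : continuous (fun x : R => f x - f 0).
  by move=> x; apply: continuousB; [exact: cf|exact: cvg_cst].
exists (f 1 - f 0), (f 0) => x.
by rewrite mulrC -(continuous_additive_linear ch hD) subrK.
Qed.

Lemma coord_pointwise_activation (R : realType) (V : vectType R)
    (X : (\dim {:V}).-tuple V) (f : R -> R) (v : V) i :
  basis_of {:V} X -> coord X i (pointwise_activation X f v) = f (coord X i v).
Proof. by move=> /basis_free fX; rewrite coord_sum_free. Qed.

(** The [i]-th coordinate of the commutation is a functional equation for [f] whose coefficients are
    row [i] of [T]; two nonzero entries would make [f] affine. *)
Lemma commute_activation_monomial (R : realType) (V : vectType R)
    (X : (\dim {:V}).-tuple V) (f : R -> R) (T : 'End(V)) :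
  basis_of {:V} X -> continuous f -> ~ affine_function f ->
  (forall v, pointwise_activation X f (T v) = T (pointwise_activation X f v)) ->
  forall i, exists j c, forall v, coord X i (T v) = c * coord X j v.
Proof.
move=> bX cf naf fT i; pose m (j : 'I_(\dim {:V})) := coord X i (T X`_j).
have coordT (w : 'I_(\dim {:V}) -> R) :
    coord X i (T (\sum_j w j *: X`_j)) = \sum_j w j * m j.
  by rewrite !linear_sum; apply: eq_bigr => j _; rewrite !linearZ.
have fm w : f (\sum_j w j * m j) = \sum_j f (w j) * m j.
  rewrite -(coordT w) -(coord_pointwise_activation f _ _ bX) fT -(coordT (f \o w)).
  congr (coord X i (T _)); apply: eq_bigr => j _.
  by rewrite coord_sum_free ?(basis_free bX).
have coordTv v : coord X i (T v) = \sum_j coord X j v * m j.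
  by rewrite -coordT -(coord_basis bX (memvf v)).
have [j mj|m0] := pickP (fun j => m j != 0); last first.
  (* On a zero row any index serves, with scalar 0. *)
  exists i, 0 => v; rewrite coordTv mul0r big1// => j _.
  by have /negbFE/eqP-> := m0 j; rewrite mulr0.
exists j, (m j) => v; rewrite coordTv (bigD1 j)//= big1 ?addr0 1?mulrC//.
move=> l lj; have [->|ml] := eqVneq (m l) 0; first by rewrite mulr0.
by case: naf; apply: (affine_of_commute_combination cf fm lj ml mj).
Qed.

(** * Reflections and the lines they move *)

Section Householder.
Variables (R : realType) (n : nat).
Implicit Types p u v : 'rV[R]_n.

Definition dot u v : R := (u *m v^T) 0 0.

Lemma dotC u v : dot u v = dot v u.
Proof. by rewrite /dot -[u *m _]trmxK trmx_mul trmxK mxE. Qed.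

Lemma dotDl u u' v : dot (u + u') v = dot u v + dot u' v.
Proof. by rewrite /dot mulmxDl mxE. Qed.

Lemma dotZl a u v : dot (a *: u) v = a * dot u v.
Proof. by rewrite /dot -scalemxAl mxE. Qed.

Lemma dot_gt0 u : u != 0 -> 0 < dot u u.
Proof.
move=> u0; have dE : dot u u = \sum_j u 0 j ^+ 2.
  by rewrite /dot mxE; apply: eq_bigr => j _; rewrite mxE expr2.
have ge0 j : true -> 0 <= u 0 j ^+ 2 by rewrite sqr_ge0.
rewrite dE lt_def sumr_ge0// andbT; apply: contraNneq u0 => /psumr_eq0P uj.
by apply/eqP/rowP => j; apply/eqP; rewrite mxE -sqrf_eq0 uj.
Qed.

Definition householder p : 'M[R]_n := 1%:M - (2 / dot p p) *: (p^T *m p).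

Lemma mul_householder u p :
  u *m householder p = u + (- (2 * dot u p / dot p p)) *: p.
Proof.
rewrite /householder mulmxBr mulmx1 -scalemxAr mulmxA [u *m _]mx11_scalar.
by rewrite mul_scalar_mx scalerA scaleNr mulrAC.
Qed.

(** The reflection is symmetric and an involution, so its transpose is its inverse. *)
Lemma householder_orthogonal p :
  p != 0 -> (householder p)^T *m householder p = 1%:M.
Proof.
move=> /dot_gt0; rewrite lt0r => /andP[p0 _].
have -> : (householder p)^T = householder p.
  by rewrite /householder linearB/= linearZ/= trmx_mul trmxK trmx1.
have HK (u : 'rV[R]_n) : u *m householder p *m householder p = u.
  rewrite !mul_householder dotDl dotZl -addrA -scalerDl.
  rewrite -[RHS]addr0 -(scale0r p); congr (_ + _ *: _).
  by field.
by apply/row_matrixP => i; rewrite -[_ *m _]mul1mx mulmxA row_mul row_mul HK.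
Qed.

(* Reflections in the hyperplanes orthogonal to v + t u send u to pairwise
   non-parallel vectors when t >= 0 varies. *)
Lemma householder_line_injective u v w s t (c c' : R) :
  u != 0 -> v != 0 -> dot u v = 0 -> 0 <= s -> 0 <= t ->
  u *m householder (v + s *: u) = c *: w ->
  u *m householder (v + t *: u) = c' *: w -> s = t.
Proof.
move=> /dot_gt0 u0 /dot_gt0 v0 uv s0 t0.
have vu : dot v u = 0 by rewrite dotC.
have dE r x : dot (u *m householder (v + r *: u)) x = dot u x -
    2 * (r * dot u u) / (dot v v + r ^+ 2 * dot u u) * (dot v x + r * dot u x).
  rewrite mul_householder dotDl dotZl mulNr.
  rewrite ![dot _ (v + _)]dotC !dotDl !dotZl !vu add0r.
  rewrite [dot v (v + _)]dotC [dot u (v + _)]dotC !dotDl !dotZl uv vu.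
  by rewrite mulr0 addr0 add0r [in LHS](mulrA r r) -expr2.
have Ds r : dot v v + r ^+ 2 * dot u u != 0.
  by rewrite gt_eqF// ltr_pwDl// mulr_ge0 ?sqr_ge0 ?ltW.
move=> es et.
have := dE s u; have := dE s v; have := dE t u; have := dE t v.
rewrite es et !dotZl uv vu => tv tu sv su.
(* Both images are multiples of [w], so the 2x2 determinant of their inner products with [u] and [v]
   vanishes. *)
have : c * dot w u * (c' * dot w v) = c' * dot w u * (c * dot w v) by ring.
rewrite tv tu sv su => /eqP; rewrite -subr_eq0.
move: (dot u u) (dot v v) u0 v0 Ds => U V u0 v0 Ds.
(* In the factored determinant only [s - t] can vanish: [V + s * t * U] is positive because [s] and
   [t] are nonnegative. *)
have -> : (U - 2 * (s * U) / (V + s ^+ 2 * U) * (0 + s * U)) *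
    (0 - 2 * (t * U) / (V + t ^+ 2 * U) * (V + t * 0)) -
    (U - 2 * (t * U) / (V + t ^+ 2 * U) * (0 + t * U)) *
    (0 - 2 * (s * U) / (V + s ^+ 2 * U) * (V + s * 0)) =
    2 * (s - t) * (V + s * t * U) * (U ^+ 2 * V) /
    ((V + s ^+ 2 * U) * (V + t ^+ 2 * U)).
  by field; rewrite !Ds.
have V0 : V + s * t * U != 0 by rewrite gt_eqF// ltr_pwDl// !mulr_ge0// ltW.
rewrite !mulf_eq0 invr_eq0 !mulf_eq0 !(negbTE (Ds _)) (negbTE V0).
rewrite !(gt_eqF u0, gt_eqF v0) pnatr_eq0/= !orbF subr_eq0.
by move/eqP.
Qed.

End Householder.

Lemma exists_orthogonal (R : realType) (n : nat) (u : 'rV[R]_n) :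
  (1 < n)%N -> exists2 v : 'rV[R]_n, v != 0 & dot u v = 0.
Proof.
(* The kernel of the column [u^T] has dimension at least [n - 1 > 0]. *)
move=> n1; exists (nz_row (kermx u^T)).
  rewrite nz_row_eq0 -mxrank_eq0 mxrank_ker subn_eq0 -ltnNge.
  by rewrite (leq_ltn_trans (rank_leq_col _)).
rewrite dotC /dot; have /sub_kermxP-> : (nz_row (kermx u^T) <= kermx u^T)%MS.
  exact: nz_row_sub.
by rewrite mxE.
Qed.

(* In odd dimension -1 has negative determinant, so O(3) is SO(3) up to sign. *)
Lemma orthogonal_or_opp_special (R : realType) (H : 'M[R]_3) :
  H^T *m H = 1%:M -> special_orthogonal H \/ special_orthogonal (- H).
Proof.
move=> oH; rewrite /special_orthogonal mulmxN [(- H)^T]linearN mulNmx opprK oH eqxx/=.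
rewrite -scaleN1r detZ -signr_odd/= expr1 mulN1r oppr_gt0.
have : \det H != 0.
  apply/eqP => H0; have := congr1 determinant oH.
  by rewrite det_mulmx H0 mulr0 det1 => /esym/eqP; rewrite oner_eq0.
by rewrite neq_lt => /orP[]; [right|left].
Qed.

(** Pigeonhole: if [u i] were nonzero, [d + 1] reflections would send it to pairwise non-parallel
    vectors, each on one of the [d] lines spanned by the [u j]. *)
Lemma rotation_permuted_lines_zero (R : realType) (d : nat)
    (u : 'I_d -> 'rV[R]_3) :
  (forall (A : SO3 R) i, exists j c, u i *m so3_mx A = c *: u j) ->
  forall i, u i = 0.
Proof.
move=> hu i; apply/eqP/negPn/negP => u0.
(* Reflections are not rotations, but their opposites are; the scalar [c] absorbs the sign. *)
have hO (H : 'M[R]_3) : H^T *m H = 1%:M -> exists j c, u i *m H = c *: u j.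
  move=> /orthogonal_or_opp_special[] sH; have [j [c e]] := hu (MkSO3 sH) i.
    by exists j, c.
  by exists j, (- c); rewrite scaleNr -e /= mulmxN opprK.
have [v v0 uv] := exists_orthogonal (u i) (isT : (1 < 3)%N).
have p0 (r : 'I_d.+1) : v + r%:R *: u i != 0.
  have dot0 : dot 0 v = 0 by rewrite /dot mul0mx mxE.
  apply/eqP => /(congr1 (fun w => dot w v))/eqP.
  by rewrite dotDl dotZl uv mulr0 addr0 dot0 gt_eqF// dot_gt0.
have /choice[s hs] (r : 'I_d.+1) :
    exists j, exists c, u i *m householder (v + r%:R *: u i) = c *: u j.
  by apply: hO; apply: householder_orthogonal; exact: p0.
suff /leq_card : injective s by rewrite !card_ord ltnn.
move=> r t srt; have [c hr] := hs r; have [c' ht] := hs t.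
apply: val_inj; apply/eqP; rewrite -(eqr_nat R); apply/eqP.
rewrite srt in hr.
exact: householder_line_injective u0 v0 uv (ler0n _ _) (ler0n _ _) hr ht.
Qed.

(** * Equivariant linear layers on tensors *)

Section TensorLayer.
Variables (R : realType) (n k : nat) (W : vectType R).

Lemma tensors_decomposition (x : tensors R n k) :
  x = \sum_I \sum_a x I a 0 *: pure_tensor (delta_mx a 0) I.
Proof.
apply/ffunP => J.
have sumE (T : finType) (F : T -> tensors R n k) :
    (\sum_i F i : tensors R n k) J = \sum_i F i J.
  by apply: (big_morph (fun y : tensors R n k => y J)) => [y z|]; rewrite ffunE.
rewrite sumE (bigD1 J)//= [X in _ + X]big1 ?addr0; last first.
  move=> I IJ; rewrite sumE big1// => a _.
  by rewrite !ffunE eq_sym (negbTE IJ) scaler0.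
rewrite sumE [LHS]matrix_sum_delta; apply: eq_bigr => a _.
by rewrite big_ord1 !ffunE eqxx.
Qed.

(** A bare family [T] indexed by rotations covers representations of both SO(3) x S_n and E(3) x
    S_n. *)
Lemma rotation_equivariant_zero (T : SO3 R -> 'End(W))
    (X : (\dim {:W}).-tuple W) (f : R -> R) (L : {linear tensors R n k -> W}) :
  basis_of {:W} X -> continuous f -> ~ affine_function f ->
  (forall A w,
    pointwise_activation X f (T A w) = T A (pointwise_activation X f w)) ->
  (forall A x, L (so3_tensor_act (A, 1%g) x) = T A (L x)) ->
  forall x, L x = 0.
Proof.
move=> bX cf naf fT LT.
have perm1I (I : multi_index n k) : perm_index 1%g I = I.
  by apply/ffunP => j; rewrite ffunE perm1.
have pureE v (I : multi_index n k) :
    pure_tensor v I = \sum_a v a 0 *: pure_tensor (delta_mx a 0) I :> tensors R n k.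
  rewrite [LHS]tensors_decomposition (bigD1 I)//= [X in _ + X]big1 ?addr0.
    by apply: eq_bigr => a _; rewrite ffunE eqxx.
  move=> J /negbTE JI; rewrite big1// => a _.
  by rewrite ffunE JI mxE scale0r.
(* The row of the [i]-th coordinate of [L] restricted to the block of [I]. *)
pose u I i : 'rV[R]_3 :=
  \row_a coord X i (L (pure_tensor (delta_mx a 0) I)).
have uE I i (v : 'cV[R]_3) :
    coord X i (L (pure_tensor v I)) = \sum_a u I i 0 a * v a 0.
  rewrite pureE !linear_sum; apply: eq_bigr => a _.
  by rewrite !linearZ/= mxE mulrC.
have u0 I i : u I i = 0.
  apply: (rotation_permuted_lines_zero (u := u I)) => A {}i.
  have [j [c jc]] := commute_activation_monomial bX cf naf (fT A) i.
  (* The identity permutation keeps the block [I], so rotating the input multiplies the row by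
     [so3_mx A] on the right. *)
  exists j, c; apply/rowP => a; rewrite !mxE -jc -LT so3_tensor_act_pure perm1I.
  by rewrite uE; apply: eq_bigr => b _; rewrite -colE [col _ _ _ _]mxE.
have pure0 I a : L (pure_tensor (delta_mx a 0) I) = 0.
  rewrite [LHS](coord_basis bX (memvf _)) big1// => i _.
  by have /rowP/(_ a) := u0 I i; rewrite !mxE => ->; rewrite scale0r.
move=> x; rewrite [x]tensors_decomposition linear_sum big1// => I _.
by rewrite linear_sum big1// => a _; rewrite linearZ/= pure0 scaler0.
Qed.

End TensorLayer.

(** * Propagation through networks *)

Lemma network_constant (R : realType) (n k m : nat) (V : vectType R)
    (rho : representation (E3 R * symg n)%type V) (Phi : tensors R n k -> V) :
  network (@e3_tensor_act R n k) (fun f => ~ affine_function f) m rho Phi ->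
  (0 < m)%N -> forall x y, Phi x = Phi y.
Proof.
(* Constancy starts only after the first activation, so the induction carries affinity and
   equivariance at depth 0. *)
suff H : network (@e3_tensor_act R n k) (fun f => ~ affine_function f) m rho Phi ->
    if m is 0 then affine_map Phi /\ equivariant (@e3_tensor_act R n k) rho Phi
    else forall x y, Phi x = Phi y.
  by move=> /H; case: m {H}.
elim=> [//|{rho}{}m {}V W rho sigma {}Phi X f phi _ IH bX cf naf fX _ _ x y].
congr (phi (pointwise_activation X f _)).
case: m IH => [[[L [b LE]] eqPhi]|m]; last exact.
have L0 : forall z, L z = 0.
  pose T A := rep_fun rho (rotation A, 1%g).
  apply: (rotation_equivariant_zero (T := T) bX cf naf) => [A w|A z].
    exact: fX (rotation A, 1%g) w.
  have eA u : Phi (so3_tensor_act (A, 1%g) u) = T A (Phi u).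
    by rewrite -e3_tensor_act_rotation; exact: eqPhi.
  (* Rotations fix the origin, so the bias [b] is fixed by [T A]; cancelling it makes [L]
     equivariant. *)
  have act0 : so3_tensor_act (A, 1%g) (0 : tensors R n k) = 0.
    by apply/ffunP => I; rewrite !ffunE mulmx0.
  have := eA 0; rewrite act0 !LE linear0 add0r => bA.
  by have := eA z; rewrite !LE linearD/= -bA => /addIr.
by rewrite !LE !L0.
Qed.

Theorem corollary4 (R : realType) (n k : nat) (hn : (0 < n)%N) (hk : (0 < k)%N) :
  (forall (W : vectType R) (rho : representation (SO3 R * symg n)%type W),
      admissible_nonaffine rho ->
      forall L : {linear tensors R n k -> W},
        equivariant (@so3_tensor_act R n k) rho L ->
        forall x, L x = 0)
  /\
  (forall (m : nat) (V : vectType R)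
      (rho : representation (E3 R * symg n)%type V) (Phi : tensors R n k -> V),
      (0 < m)%N ->
      network (@e3_tensor_act R n k) (fun f => ~ affine_function f) m rho Phi ->
      forall (A : SO3 R) (x : tensors R n k),
        Phi (e3_tensor_act (rotation A, 1%g) x) = Phi x).
Proof.
split=> [W rho [X [f [bX cf naf fX]]] L LX|m V rho Phi m0 net A x].
  pose T A := rep_fun rho (A, 1%g).
  apply: (rotation_equivariant_zero (T := T) bX cf naf) => [A w|A x].
    exact: fX (A, 1%g) w.
  exact: LX (A, 1%g) x.
exact: network_constant net m0 _ _.
Qed.
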